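(* Let $\mathcal{O}$ be a context specifier. The operator $(-)|_{\mathcal{O}} : \mathbf{CF} \to \mathbf{CF}$, $\mathcal{C} \mapsto \mathcal{C}|_{\mathcal{O}}$, is decreasing, preserves arbitrary joins, and satisfies the fixed point transfer condition with respect to $\mathrm{In}_{\mathcal{O}} : \mathbf{PV} \to \mathbf{PV}$.
   Context: $\mathsf{FSgp}$ is the category of finite semigroups (the empty semigroup is allowed) and homomorphisms. For a finite semigroup $S$, $\mathcal{P}(S)$ is the semigroup of non-empty subsets of $S$ under $XY = \{xy : x\in X, y\in Y\}$, and $\mathrm{sing}(S) \subseteq \mathcal{P}(S)$ is the subsemigroup of singletons. A homomorphism $\varphi : S \to T$ extends to $\dot\varphi : \mathcal{P}(S) \to \mathcal{P}(T)$, $X \mapsto \{\varphi(x) : x \in X\}$. An $S$-complex is a subsemigroup of $\mathcal{P}(S)$ which contains $\mathrm{sing}(S)$ and is closed under taking non-empty subsets of its members. For $\mathcal{X} \subseteq \mathcal{P}(S)$, $\langle \mathcal{X}\rangle_S^{\mathrm{com}}$ denotes the smallest $S$-complex containing $\mathcal{X}$. A complex functor is a functor $\mathcal{C} : \mathsf{FSgp} \to \mathsf{FSgp}$ such that $\mathcal{C}(S)$ is an $S$-complex for every $S$, $\mathcal{C}(\varphi)$ is the restriction $\dot\varphi : \mathcal{C}(S) \to \mathcal{C}(T)$ for each $\varphi : S\to T$, and $\mathcal{C}$ preserves surjective homomorphisms. $\mathbf{CF}$ is the complete lattice of complex functors ordered by pointwise inclusion, with joins computed pointwise in the lattices of $S$-complexes.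 $\mathrm{Fix}(\mathcal{C}) = \{ S \in \mathsf{FSgp} : \mathcal{C}(S) = \mathrm{sing}(S) \}$, which is a pseudovariety. A context specifier $\mathcal{O}$ is a rule assigning to each finite semigroup $S$ a (possibly empty) set $\mathcal{O}(S)$ of subsemigroups of $S$ such that: (i) for all homomorphisms $\varphi : S \to T$ and $U_S \in \mathcal{O}(S)$ there is $U_T \in \mathcal{O}(T)$ with $\varphi(U_S) \subseteq U_T$; (ii) for all surjective homomorphisms $\varphi : S \to T$ and $U_T \in \mathcal{O}(T)$ there is $U_S \in \mathcal{O}(S)$ with $\varphi(U_S) = U_T$. For $\mathcal{C}\in\mathbf{CF}$, the complex functor $\mathcal{C}|_{\mathcal{O}}$ is given by $\mathcal{C}|_{\mathcal{O}}(S) = \big\langle \bigcup_{U \in \mathcal{O}(S)} \mathcal{C}(U) \big\rangle_S^{\mathrm{com}}$. A pseudovariety is a class of finite semigroups closed under subsemigroups, homomorphic images and finite products; $\mathbf{PV}$ is the complete lattice of pseudovarieties under inclusion. For $\mathbf{V} \in \mathbf{PV}$, $\mathrm{In}_{\mathcal{O}}(\mathbf{V}) = \{ S : \mathcal{O}(S) \subseteq \mathbf{V}\}$, which is a pseudovariety. A monotone operator $\lambda$ on $\mathbf{CF}$ is algebraic if $\mathrm{Fix}(\mathcal{C}_1)=\mathrm{Fix}(\mathcal{C}_2)$ implies $\mathrm{Fix}(\lambda(\mathcal{C}_1))=\mathrm{Fix}(\lambda(\mathcal{C}_2))$. An operator on $\mathbf{PV}$ is continuous if it is monotone and preserves directed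 joins. For $\lambda$ algebraic and $\alpha$ continuous, $\lambda$ satisfies the fixed point transfer condition with respect to $\alpha$ if $\mathrm{Fix}(\lambda(\mathcal{C})) = \alpha(\mathrm{Fix}(\mathcal{C}))$ for all $\mathcal{C} \in \mathbf{CF}$. An operator $\lambda$ is decreasing if $\lambda(x)\le x$ for all $x$. *)

(* Defs.v *)
From HB Require Import structures.
From mathcomp Require Import all_boot.
From mathcomp Require Import boolp.

Set Implicit Arguments.
Unset Strict Implicit.
Unset Printing Implicit Defensive.

Local Open Scope group_scope.

(* A finType may be empty, so the empty semigroup is a finSemigroupType. *)
#[short(type="finSemigroupType")]
HB.structure Definition FinSemigroup := {S of Semigroup S & Finite S}.

Definition surjective (A B : Type) (f : A -> B) := forall y, exists x, f x = y.

Definition sgprod (I : finType) (S : I -> finSemigroupType) : Type :=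
  {dffun forall i, S i}.

Section Product.
Variables (I : finType) (S : I -> finSemigroupType).

HB.instance Definition _ := Finite.copy (sgprod S) {dffun forall i, S i}.

Definition sgprod_mul (x y : sgprod S) : sgprod S := [ffun i => x i * y i].

Lemma sgprod_mulA : associative sgprod_mul.
Proof. by move=> x y z; apply/ffunP=> i; rewrite !ffunE mulgA. Qed.

HB.instance Definition _ := isSemigroup.Build (sgprod S) sgprod_mulA.

Definition sgproj (i : I) (x : sgprod S) : S i := x i.

Lemma sgproj_mul i : {morph sgproj i : x y / x * y}.
Proof. by move=> x y; rewrite /sgproj ffunE. Qed.

HB.instance Definition _ i := isMultiplicative.Build _ _ (sgproj i) (@sgproj_mul i).

End Product.

(* The empty subsemigroup is allowed. *)
Definition is_subsgp (S : finSemigroupType) (U : {set S}) : bool :=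
  [forall x in U, forall y in U, x * y \in U].

Record subsgp (S : finSemigroupType) :=
  Subsgp { subsgp_set :> {set S}; subsgpP : is_subsgp subsgp_set }.

Lemma subsgpM (S : finSemigroupType) (U : {set S}) : is_subsgp U ->
  {in U &, forall x y, x * y \in U}.
Proof. by move=> /forall_inP h x y /h /forall_inP; apply. Qed.

Section Subsgp.
Variable S : finSemigroupType.

HB.instance Definition _ := [isSub for @subsgp_set S].
HB.instance Definition _ := [Finite of subsgp S by <:].

Variable U : subsgp S.

Record subsgp_elt := SubsgpElt { sgincl : S; sginclP : sgincl \in subsgp_set U }.

HB.instance Definition _ := [isSub for sgincl].
HB.instance Definition _ := [Finite of subsgp_elt by <:].

Definition subsgp_mul (x y : subsgp_elt) : subsgp_elt :=
  SubsgpElt (subsgpM (subsgpP U) (sginclP x) (sginclP y)).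

Lemma subsgp_mulA : associative subsgp_mul.
Proof. by move=> x y z; apply: val_inj; rewrite /= mulgA. Qed.

HB.instance Definition _ := isSemigroup.Build subsgp_elt subsgp_mulA.

Lemma sgincl_mul : {morph sgincl : x y / x * y}.
Proof. by []. Qed.

HB.instance Definition _ := isMultiplicative.Build _ _ sgincl sgincl_mul.

End Subsgp.

Definition subsgp_sgp (S : finSemigroupType) (U : subsgp S) : finSemigroupType :=
  subsgp_elt U.

Record pset (S : finType) :=
  PSet { pset_val :> {set S}; pset_neq0 : pset_val != set0 }.

HB.instance Definition _ S := [isSub for @pset_val S].
HB.instance Definition _ S := [Finite of pset S by <:].

Section PowerSemigroup.
Variable S : finSemigroupType.

Lemma pset_mul_subproof (X Y : pset S) : (@mul S) @2: (X, Y) != set0.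
Proof.
have [/set0Pn[x Xx] /set0Pn[y Yy]] := (pset_neq0 X, pset_neq0 Y).
by apply/set0Pn; exists (x * y); apply: imset2_f.
Qed.

Definition pset_mul (X Y : pset S) : pset S := PSet (pset_mul_subproof X Y).

Lemma pset_mulA : associative pset_mul.
Proof.
move=> X Y Z; apply/val_inj/setP=> t /=; apply/imset2P/imset2P.
- case=> x _ Xx /imset2P[y z Yy Zz ->] ->; exists (x * y) z => //.
    exact: imset2_f.
  by rewrite mulgA.
- case=> _ z /imset2P[x y Xx Yy ->] Zz ->; exists x (y * z) => //.
    exact: imset2_f.
  by rewrite mulgA.
Qed.

HB.instance Definition _ := isSemigroup.Build (pset S) pset_mulA.

Lemma pset1_subproof (x : S) : [set x] != set0.
Proof. by apply/set0Pn; exists x; rewrite inE. Qed.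

Definition pset1 (x : S) : pset S := PSet (pset1_subproof x).

Definition sing : {set pset S} := [set pset1 x | x : S].

End PowerSemigroup.

Lemma pset_map_subproof (S T : finType) (f : S -> T) (X : pset S) : f @: X != set0.
Proof.
have /set0Pn[x Xx] := pset_neq0 X.
by apply/set0Pn; exists (f x); apply: imset_f.
Qed.

Definition pset_map (S T : finType) (f : S -> T) (X : pset S) : pset T :=
  PSet (pset_map_subproof f X).

Lemma pset_mapM (S T : finSemigroupType) (f : {multiplicative S -> T}) :
  {morph pset_map f : X Y / X * Y}.
Proof.
move=> X Y; apply/val_inj/setP=> t /=; apply/imsetP/imset2P.
- case=> _ /imset2P[x y Xx Yy ->] ->.
  by exists (f x) (f y); rewrite ?gmulfM ?imset_f.
- case=> _ _ /imsetP[x Xx ->] /imsetP[y Yy ->] ->; exists (x * y).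
    exact: imset2_f.
  by rewrite gmulfM.
Qed.

Lemma pset_map_sing (S T : finSemigroupType) (f : S -> T) (X : pset S) :
  X \in sing S -> pset_map f X \in sing T.
Proof.
case/imsetP=> x _ ->; apply/imsetP; exists (f x) => //.
by apply: val_inj; rewrite /= imset_set1.
Qed.

Lemma pset_map_comp (S T R : finType) (g : T -> R) (f : S -> T) (X : pset S) :
  pset_map (g \o f) X = pset_map g (pset_map f X).
Proof. by apply: val_inj; rewrite /= imset_comp. Qed.

Lemma eq_pset_map (S T : finType) (f g : S -> T) : f =1 g -> pset_map f =1 pset_map g.
Proof. by move=> fg X; apply/val_inj/eq_imset. Qed.

Section Complex.
Variable S : finSemigroupType.
Implicit Types (K G : {set pset S}) (X Y : pset S).

Definition is_complex K : bool :=
  [&& is_subsgp K, sing S \subset K &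
      [forall X in K, forall Y : pset S, (pset_val Y \subset X) ==> (Y \in K)]].

Record complex := Complex { complex_set :> {set pset S}; complexP : is_complex complex_set }.

Lemma is_complexP K :
  reflect [/\ {in K &, forall X Y, X * Y \in K}, {subset sing S <= K}
            & forall X Y, X \in K -> pset_val Y \subset X -> Y \in K]
          (is_complex K).
Proof.
apply: (iffP and3P) => [[/subsgpM KM /subsetP Ks /forall_inP Kd]|[KM Ks Kd]].
  by split=> // X Y /Kd /forallP /(_ Y) /implyP; apply.
split; [|exact/subsetP|].
  by apply/forall_inP=> X KX; apply/forall_inP=> Y; apply: KM.
by apply/forall_inP=> X KX; apply/forallP=> Y; apply/implyP; apply: Kd.
Qed.

Definition complex_subsgp (K : complex) : subsgp (pset S) :=
  Subsgp (proj1 (andP (complexP K))).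

Definition complex_gen_set G : {set pset S} :=
  \bigcap_(K : {set pset S} | is_complex K && (G \subset K)) K.

Lemma complex_gen_subproof G : is_complex (complex_gen_set G).
Proof.
apply/is_complexP; split=> [X Y gX gY|X sX|X Y gX YX]; apply/bigcapP=> K GK.
- have /andP[/is_complexP[KM _ _] _] := GK.
  by apply: KM; [apply: (bigcapP gX)|apply: (bigcapP gY)].
- by have /andP[/is_complexP[_ Ks _] _] := GK; apply: Ks.
- have /andP[/is_complexP[_ _ Kd] _] := GK.
  by apply: Kd YX; apply: (bigcapP gX).
Qed.

Definition complex_gen G : complex := Complex (complex_gen_subproof G).

Lemma sub_complex_gen G : G \subset complex_gen G.
Proof. by apply/bigcapsP=> K /andP[]. Qed.

Lemma complex_gen_min G (K : complex) : G \subset K -> complex_gen G \subset K.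
Proof. by move=> GK; apply: bigcap_inf; rewrite complexP. Qed.

End Complex.

Lemma is_complex_preim (S T : finSemigroupType) (f : {multiplicative S -> T})
  (K : complex T) : is_complex (pset_map f @^-1: K).
Proof.
have /is_complexP[KM Ks Kd] := complexP K.
apply/is_complexP; split=> [X Y|X sX|X Y]; rewrite !inE.
- by rewrite pset_mapM; apply: KM.
- exact/Ks/pset_map_sing.
- by move=> KX YX; apply: Kd KX _; apply: imsetS.
Qed.

Lemma is_complex_im (S T : finSemigroupType) (f : {multiplicative S -> T})
  (K : complex S) : surjective f -> is_complex (pset_map f @: K).
Proof.
move=> fsurj; have /is_complexP[KM Ks Kd] := complexP K.
apply/is_complexP; split.
- move=> _ _ /imsetP[X KX ->] /imsetP[Y KY ->].
  by rewrite -pset_mapM; apply/imset_f/KM.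
- move=> _ /imsetP[y _ ->]; have [x <-] := fsurj y.
  apply/imsetP; exists (pset1 x); first exact/Ks/imset_f.
  by apply: val_inj; rewrite /= imset_set1.
- move=> _ Y /imsetP[X KX ->] YX.
  have Z0 : (X :&: f @^-1: Y) != set0.
    have /set0Pn[y Yy] := pset_neq0 Y; have /imsetP[x Xx yE] := subsetP YX _ Yy.
    by apply/set0Pn; exists x; rewrite !inE Xx -yE.
  apply/imsetP; exists (PSet Z0); first by apply: (Kd X) => //; apply: subsetIl.
  apply/val_inj/setP=> y /=; apply/idP/imsetP => [Yy|[x] /setIP[_]].
    have /imsetP[x Xx yE] := subsetP YX _ Yy.
    by exists x => //; rewrite !inE Xx -yE.
  by rewrite inE => Yfx ->.
Qed.

Lemma complex_gen_map (S T : finSemigroupType) (f : {multiplicative S -> T})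
    (G : {set pset S}) (K : complex T) :
  {in G, forall X, pset_map f X \in K} ->
  {in complex_gen G, forall X, pset_map f X \in K}.
Proof.
move=> GK X gX; have : complex_gen G \subset Complex (is_complex_preim f K).
  by apply: complex_gen_min; apply/subsetP=> Y /GK; rewrite inE.
by move=> /subsetP/(_ _ gX); rewrite inE.
Qed.

Lemma complex_gen_surj (S T : finSemigroupType) (f : {multiplicative S -> T})
    (G : {set pset T}) (K : complex S) : surjective f ->
  {in G, forall Y, exists2 X, X \in K & pset_map f X = Y} ->
  {in complex_gen G, forall Y, exists2 X, X \in K & pset_map f X = Y}.
Proof.
move=> fsurj GK Y gY; have : complex_gen G \subset Complex (is_complex_im K fsurj).
  by apply: complex_gen_min; apply/subsetP=> Z /GK[X KX <-]; apply: imset_f.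
by move=> /subsetP/(_ _ gY)/imsetP[X KX ->]; exists X.
Qed.

(* The action on morphisms is forced to be the restriction of pset_map; it is a
   functor FSgp -> FSgp as soon as these restrictions are well defined, see
   [cf_map], [cf_map_id] and [cf_map_comp] below. *)
Record complexFunctor := ComplexFunctor {
  cf_obj :> forall S : finSemigroupType, complex S;
  cf_pset_map : forall (S T : finSemigroupType) (f : {multiplicative S -> T}),
    {in cf_obj S, forall X, pset_map f X \in (cf_obj T : {set pset T})};
  cf_surj : forall (S T : finSemigroupType) (f : {multiplicative S -> T}),
    surjective f ->
    {in cf_obj T, forall Y, exists2 X, X \in (cf_obj S : {set pset S}) & pset_map f X = Y}
}.

Section Functoriality.
Variable C : complexFunctor.

Definition cf_sgp (S : finSemigroupType) : finSemigroupType :=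
  subsgp_sgp (complex_subsgp (C S)).

Section Map.
Variables (S T : finSemigroupType) (f : {multiplicative S -> T}).

Definition cf_map (X : cf_sgp S) : cf_sgp T :=
  @SubsgpElt _ (complex_subsgp (C T)) _ (cf_pset_map f (sginclP X)).

Lemma cf_map_mul : {morph cf_map : X Y / X * Y}.
Proof. by move=> X Y; apply: val_inj; rewrite /= pset_mapM. Qed.

HB.instance Definition _ := isMultiplicative.Build _ _ cf_map cf_map_mul.

End Map.

Lemma cf_map_id S (X : cf_sgp S) : cf_map idfun X = X.
Proof. by do 2!apply: val_inj; rewrite /= imset_id. Qed.

Lemma cf_map_comp (S T R : finSemigroupType) (g : {multiplicative T -> R}) (f : {multiplicative S -> T})
  (X : cf_sgp S) : cf_map (g \o f) X = cf_map g (cf_map f X).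
Proof. by do 2!apply: val_inj; rewrite /= -imset_comp. Qed.

Lemma cf_map_surj (S T : finSemigroupType) (f : {multiplicative S -> T}) :
  surjective f -> surjective (cf_map f).
Proof.
move=> /(cf_surj (c := C)) fsurj [Y CY]; have [X CX XY] := fsurj Y CY.
by exists (@SubsgpElt _ (complex_subsgp (C S)) _ CX); apply: val_inj.
Qed.

End Functoriality.

Definition cf_le (C D : complexFunctor) : Prop :=
  forall S : finSemigroupType, (C S : {set pset S}) \subset D S.

Lemma cf_le_anti C D : cf_le C D -> cf_le D C -> C = D.
Proof.
move=> CD DC.
have e : cf_obj C = cf_obj D.
  apply: functional_extensionality_dep => S.
  have := conj (CD S) (DC S); case: (C S) (D S) => [K Kc] [L Lc] /= [KL LK].
  have E : K = L by apply/eqP; rewrite eqEsubset KL.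
  by case: _ / E Lc {KL LK} => Lc; congr Complex; apply: Prop_irrelevance.
case: C D e {CD DC} => [c m s] [d m' s'] /= e; case: _ / e m' s' => m' s'.
by congr ComplexFunctor; apply: Prop_irrelevance.
Qed.

(* Subsets of CF and PV are plain predicates: these types live above the
   universe of MathComp's finite types, hence out of reach of its [set]. *)
Definition cf_join_set (A : complexFunctor -> Prop) (S : finSemigroupType) : {set pset S} :=
  [set X | `[< exists2 C : complexFunctor, A C & X \in (C S : {set pset S}) >]].

Section Join.
Variable A : complexFunctor -> Prop.

Lemma cf_join_pset_map (S T : finSemigroupType) (f : {multiplicative S -> T}) :
  {in complex_gen (cf_join_set A S), forall X,
     pset_map f X \in (complex_gen (cf_join_set A T) : {set pset T})}.
Proof.
apply: complex_gen_map => X; rewrite inE => /asboolP[C AC CX].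
apply: (subsetP (sub_complex_gen _)); rewrite inE; apply/asboolP.
by exists C => //; apply: cf_pset_map.
Qed.

Lemma cf_join_surj (S T : finSemigroupType) (f : {multiplicative S -> T}) :
  surjective f ->
  {in complex_gen (cf_join_set A T), forall Y,
     exists2 X, X \in (complex_gen (cf_join_set A S) : {set pset S}) & pset_map f X = Y}.
Proof.
move=> fsurj; apply: complex_gen_surj => // Y; rewrite inE => /asboolP[C AC CY].
have [X CX <-] := cf_surj fsurj CY; exists X => //.
by apply: (subsetP (sub_complex_gen _)); rewrite inE; apply/asboolP; exists C.
Qed.

Definition cf_join : complexFunctor := ComplexFunctor cf_join_pset_map cf_join_surj.

Lemma cf_join_ub C : A C -> cf_le C cf_join.
Proof.
move=> AC S; apply: subset_trans (sub_complex_gen _).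
by apply/subsetP=> X CX; rewrite inE; apply/asboolP; exists C.
Qed.

Lemma cf_join_least D : (forall C, A C -> cf_le C D) -> cf_le cf_join D.
Proof.
move=> AD S; apply: complex_gen_min; apply/subsetP=> X.
by rewrite inE => /asboolP[C /AD/(_ S)/subsetP]; apply.
Qed.

End Join.

Record contextSpecifier := ContextSpecifier {
  ctx_set :> forall S : finSemigroupType, {set subsgp S};
  ctx_map : forall (S T : finSemigroupType) (f : {multiplicative S -> T}),
    {in ctx_set S, forall U, exists2 V, V \in ctx_set T & f @: subsgp_set U \subset subsgp_set V};
  ctx_surj : forall (S T : finSemigroupType) (f : {multiplicative S -> T}),
    surjective f ->
    {in ctx_set T, forall V, exists2 U, U \in ctx_set S & f @: subsgp_set U = subsgp_set V}
}.

Section SubsgpMap.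
Variables (S T : finSemigroupType) (f : {multiplicative S -> T}).
Variables (U : subsgp S) (V : subsgp T).
Hypothesis fUV : f @: subsgp_set U \subset subsgp_set V.

Definition subsgp_map (x : subsgp_sgp U) : subsgp_sgp V :=
  SubsgpElt (subsetP fUV _ (imset_f f (sginclP x))).

Lemma subsgp_map_mul : {morph subsgp_map : x y / x * y}.
Proof. by move=> x y; apply: val_inj; rewrite /= gmulfM. Qed.

HB.instance Definition _ := isMultiplicative.Build _ _ subsgp_map subsgp_map_mul.

End SubsgpMap.

Lemma subsgp_map_surj (S T : finSemigroupType) (f : {multiplicative S -> T}) (U : subsgp S) (V : subsgp T)
    (fUV : f @: subsgp_set U \subset subsgp_set V) :
  f @: subsgp_set U = subsgp_set V -> surjective (subsgp_map fUV).
Proof.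
move=> e [y Vy]; have := Vy; rewrite -e => /imsetP[x Ux yE].
by exists (SubsgpElt Ux : subsgp_sgp U); apply: val_inj; rewrite /= yE.
Qed.

Section Restrict.
Variables (O : contextSpecifier) (C : complexFunctor).

(* C(U) is a set of subsets of U; [pset_map (@sgincl S U)] regards these as subsets
   of S. *)
Definition cf_restrict_set (S : finSemigroupType) : {set pset S} :=
  \bigcup_(U in O S) (pset_map (@sgincl S U) @: C (subsgp_sgp U)).

Lemma cf_restrict_pset_map (S T : finSemigroupType) (f : {multiplicative S -> T}) :
  {in complex_gen (cf_restrict_set S), forall X,
     pset_map f X \in (complex_gen (cf_restrict_set T) : {set pset T})}.
Proof.
apply: complex_gen_map => _ /bigcupP[U OU /imsetP[X CX ->]].
have [V OV fUV] := ctx_map f OU.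
apply: (subsetP (sub_complex_gen _)); apply/bigcupP; exists V => //.
apply/imsetP; exists (pset_map (subsgp_map fUV) X); first exact: cf_pset_map.
by rewrite -!pset_map_comp; apply: eq_pset_map.
Qed.

Lemma cf_restrict_surj (S T : finSemigroupType) (f : {multiplicative S -> T}) :
  surjective f ->
  {in complex_gen (cf_restrict_set T), forall Y,
     exists2 X, X \in (complex_gen (cf_restrict_set S) : {set pset S}) & pset_map f X = Y}.
Proof.
move=> fsurj; apply: complex_gen_surj => // _ /bigcupP[V OV /imsetP[Y CY ->]].
have [U OU fU] := ctx_surj fsurj OV.
have fUV : f @: subsgp_set U \subset subsgp_set V by rewrite fU.
have [X CX <-] := cf_surj (subsgp_map_surj fUV fU) CY.
exists (pset_map (@sgincl S U) X); last by rewrite -!pset_map_comp; apply: eq_pset_map.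
apply: (subsetP (sub_complex_gen _)); apply/bigcupP; exists U => //.
exact: imset_f.
Qed.

Definition cf_restrict : complexFunctor :=
  ComplexFunctor cf_restrict_pset_map cf_restrict_surj.

End Restrict.

(* Closure under subsemigroups is stated for the subsemigroups of S themselves;
   closure under isomorphic copies is part of closure under homomorphic images.
   The case of an empty index type I puts the trivial semigroup in every
   pseudovariety. *)
Record pseudovariety := Pseudovariety {
  pv_class :> finSemigroupType -> Prop;
  pv_sub : forall (S : finSemigroupType) (U : subsgp S),
    pv_class S -> pv_class (subsgp_sgp U);
  pv_im : forall (S T : finSemigroupType) (f : {multiplicative S -> T}),
    surjective f -> pv_class S -> pv_class T;
  pv_prod : forall (I : finType) (S : I -> finSemigroupType),
    (forall i, pv_class (S i)) -> pv_class (sgprod S)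
}.

Definition pv_le (V W : pseudovariety) : Prop := forall S, V S -> W S.

Lemma pv_le_anti V W : pv_le V W -> pv_le W V -> V = W.
Proof.
move=> VW WV; have e : pv_class V = pv_class W.
  by apply: functional_extensionality_dep => S; apply: propext; split; auto.
case: V W e {VW WV} => [v a b c] [w a' b' c'] /= e; case: _ / e a' b' c' => a' b' c'.
by congr Pseudovariety; apply: Prop_irrelevance.
Qed.

Section PvJoin.
Variable A : pseudovariety -> Prop.

Definition pv_join_class (S : finSemigroupType) : Prop :=
  forall W : pseudovariety, (forall V, A V -> pv_le V W) -> W S.

Fact pv_join_sub (S : finSemigroupType) (U : subsgp S) :
  pv_join_class S -> pv_join_class (subsgp_sgp U).
Proof. by move=> jS W AW; apply/pv_sub/jS. Qed.

Fact pv_join_im (S T : finSemigroupType) (f : {multiplicative S -> T}) :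
  surjective f -> pv_join_class S -> pv_join_class T.
Proof. by move=> fsurj jS W AW; apply: pv_im fsurj _; apply: jS. Qed.

Fact pv_join_prod (I : finType) (S : I -> finSemigroupType) :
  (forall i, pv_join_class (S i)) -> pv_join_class (sgprod S).
Proof. by move=> jS W AW; apply: pv_prod => i; apply: jS. Qed.

Definition pv_join : pseudovariety := Pseudovariety pv_join_sub pv_join_im pv_join_prod.

Lemma pv_join_ub V : A V -> pv_le V pv_join.
Proof. by move=> AV S VS W AW; apply: AW AV S VS. Qed.

Lemma pv_join_least W : (forall V, A V -> pv_le V W) -> pv_le pv_join W.
Proof. by move=> AW S; apply. Qed.

End PvJoin.

Lemma pv_embed (V : pseudovariety) (S T : finSemigroupType)
  (f : {multiplicative T -> S}) : injective f -> V S -> V T.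
Proof.
move=> finj VS.
have fU : is_subsgp [set f x | x : T].
  apply/forall_inP=> _ /imsetP[x _ ->]; apply/forall_inP=> _ /imsetP[y _ ->].
  by rewrite -gmulfM imset_f.
pose U := Subsgp fU.
have pre (u : subsgp_sgp U) : exists x, f x = sgincl u.
  by have /imsetP[x _ ->] := sginclP u; exists x.
pose g (u : subsgp_sgp U) : T := sval (cid (pre u)).
have gK u : f (g u) = sgincl u by rewrite /g; case: cid.
have gM : {morph g : x y / x * y}.
  by move=> x y; apply: finj; rewrite gmulfM !gK.
pose gm := isMultiplicative.Build _ _ g gM.
pose G : {multiplicative subsgp_sgp U -> T} := HB.pack g gm.
apply: (@pv_im V _ _ G); last exact: pv_sub.
move=> x; have Ux : f x \in subsgp_set U by apply: imset_f.
by exists (SubsgpElt Ux : subsgp_sgp U); apply: finj; apply: gK.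
Qed.

Section Fix.
Variable C : complexFunctor.

Definition Fix_class (S : finSemigroupType) : Prop := (C S : {set pset S}) = sing S.

Lemma Fix_classP S :
  Fix_class S <-> {in C S, forall X : pset S, {in pset_val X &, forall x y, x = y}}.
Proof.
split=> [CS X CX x y Xx Xy|CS].
  by move: CX Xx Xy; rewrite CS => /imsetP[z _ ->]; rewrite !inE => /eqP-> /eqP->.
apply/setP=> X; apply/idP/idP => [CX|]; last first.
  by case/is_complexP: (complexP (C S)) => _ sC _; apply: sC.
have /set0Pn[x Xx] := pset_neq0 X; apply/imsetP; exists x => //.
apply/val_inj/setP=> y /=; rewrite inE; apply/idP/eqP => [Xy|->//].
exact: CS CX _ _ Xy Xx.
Qed.

Fact Fix_sub (S : finSemigroupType) (U : subsgp S) :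
  Fix_class S -> Fix_class (subsgp_sgp U).
Proof.
move=> /Fix_classP CS; apply/Fix_classP => X CX x y Xx Xy.
apply: val_inj; apply: (CS (pset_map (@sgincl S U) X)).
- exact: (@cf_pset_map C (subsgp_sgp U) S (@sgincl S U)).
- exact: imset_f.
- exact: imset_f.
Qed.

Fact Fix_im (S T : finSemigroupType) (f : {multiplicative S -> T}) :
  surjective f -> Fix_class S -> Fix_class T.
Proof.
move=> fsurj /Fix_classP CS; apply/Fix_classP => Y CY x y.
have [X CX <-] := cf_surj fsurj CY.
by move=> /imsetP[x' Xx ->] /imsetP[y' Xy ->]; congr (f _); apply: (CS X).
Qed.

Fact Fix_prod (I : finType) (S : I -> finSemigroupType) :
  (forall i, Fix_class (S i)) -> Fix_class (sgprod S).
Proof.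
move=> CS; apply/Fix_classP => X CX x y Xx Xy; apply/ffunP=> i.
have /Fix_classP Ci := CS i; apply: (Ci (pset_map (@sgproj _ S i) X)).
- exact: (@cf_pset_map C (sgprod S) (S i) (@sgproj _ S i)).
- exact: (imset_f (@sgproj _ S i)).
- exact: (imset_f (@sgproj _ S i)).
Qed.

Definition Fix : pseudovariety := Pseudovariety Fix_sub Fix_im Fix_prod.

End Fix.

Section InO.
Variables (O : contextSpecifier) (V : pseudovariety).

Definition In_class (S : finSemigroupType) : Prop :=
  forall U : subsgp S, U \in O S -> V (subsgp_sgp U).

Fact In_sub (S : finSemigroupType) (U : subsgp S) :
  In_class S -> In_class (subsgp_sgp U).
Proof.
move=> IS W OW; have [W' OW' sW] := ctx_map (@sgincl S U) OW.
apply: (@pv_embed V _ _ (subsgp_map sW)); last exact: IS.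
by move=> x y [] /val_inj/val_inj.
Qed.

Fact In_im (S T : finSemigroupType) (f : {multiplicative S -> T}) :
  surjective f -> In_class S -> In_class T.
Proof.
move=> fsurj IS W OW; have [U OU fU] := ctx_surj fsurj OW.
have fUW : f @: subsgp_set U \subset subsgp_set W by rewrite fU.
exact: pv_im (subsgp_map_surj fUW fU) (IS _ OU).
Qed.

Fact In_prod (I : finType) (S : I -> finSemigroupType) :
  (forall i, In_class (S i)) -> In_class (sgprod S).
Proof.
move=> IS W OW.
have OWi i := cid2 (ctx_map (@sgproj _ S i) OW).
pose R i : finSemigroupType := subsgp_sgp (s2val (OWi i)).
pose g (x : subsgp_sgp W) : sgprod R := [ffun i => subsgp_map (s2valP' (OWi i)) x].
have gM : {morph g : x y / x * y}.
  by move=> x y; apply/ffunP=> i; rewrite !ffunE; apply: gmulfM.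
pose gm := isMultiplicative.Build _ _ g gM.
pose G : {multiplicative subsgp_sgp W -> sgprod R} := HB.pack g gm.
apply: (@pv_embed V _ _ G); last by apply: pv_prod => i; exact: IS i _ (s2valP (OWi i)).
move=> x y xy; apply/val_inj/ffunP=> i.
by have /ffunP/(_ i) := xy; rewrite !ffunE => /(congr1 val).
Qed.

Definition In_pv : pseudovariety := Pseudovariety In_sub In_im In_prod.

End InO.

Section Operators.
Variables (T : Type) (le : T -> T -> Prop) (join : (T -> Prop) -> T).
Variable f : T -> T.

Definition decreasing := forall x, le (f x) x.

Definition monotone := forall x y, le x y -> le (f x) (f y).

Definition image_pred (A : T -> Prop) : T -> Prop :=
  fun y => exists2 x, A x & y = f x.

Definition directed (A : T -> Prop) :=
  (exists x, A x) /\
  (forall x y, A x -> A y -> exists z, [/\ A z, le x z & le y z]).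

Definition preserves_joins := forall A, f (join A) = join (image_pred A).

Definition preserves_directed_joins :=
  forall A, directed A -> f (join A) = join (image_pred A).

End Operators.

Definition algebraic (l : complexFunctor -> complexFunctor) :=
  monotone cf_le l /\
  (forall C D, Fix C = Fix D -> Fix (l C) = Fix (l D)).

Definition continuous (a : pseudovariety -> pseudovariety) :=
  monotone pv_le a /\ preserves_directed_joins pv_le pv_join a.

(* The condition only makes sense for l algebraic and a continuous, hence the
   first two conjuncts. *)
Definition fixed_point_transfer (l : complexFunctor -> complexFunctor)
    (a : pseudovariety -> pseudovariety) :=
  [/\ algebraic l, continuous a & forall C, Fix (l C) = a (Fix C)].

(* Main.v *)
Require Import Defs.
From mathcomp Require Import all_boot.
From mathcomp Require Import boolp.

(** The set [cf_restrict_set O C S] of generators of the restriction at [S]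
   consists of the images in [S] of the members of [C U], for [U] in [O S].
   Everything follows from two remarks about it.

   Since [C] is functorial, these images already lie in [C S]; so the
   restriction is decreasing.  Since the complex generated by a set is carried
   along the inclusion of [U] into [S] by its generators alone
   ([complex_gen_map]), taking joins at [U] first and then restricting gives no
   more than restricting first and then taking joins at [S]
   ([cf_restrict_join]).

   The singletons form a complex, so the restriction is trivial at [S] exactly
   when all generators are singletons; as inclusions are injective, this says
   that [C U] is trivial for every [U] in [O S], which is membership of [S] in
   [In_pv O (Fix C)] ([Fix_cf_restrict]).  Algebraicity is then immediate.
   Continuity of [In_pv O] is a compactness argument: a directed join of
   pseudovarieties is a union ([mem_directed_pv_join]), and [O S] is finite, so one
   member of the directed family contains all of [O S]. *)

Set Implicit Arguments.
Unset Strict Implicit.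
Unset Printing Implicit Defensive.

Local Open Scope group_scope.

Lemma sing_subsingleton (S : finSemigroupType) (X : pset S) :
  {in pset_val X &, forall x y, x = y} -> X \in sing S.
Proof.
move=> Xs; have /set0Pn[x Xx] := pset_neq0 X; apply/imsetP; exists x => //.
apply/val_inj/setP=> y /=; rewrite inE; apply/idP/eqP => [Xy|->//].
exact: Xs.
Qed.

Lemma subsingleton_sing (S : finSemigroupType) (X : pset S) :
  X \in sing S -> {in pset_val X &, forall x y, x = y}.
Proof. by case/imsetP=> z _ -> x y; rewrite !inE => /eqP-> /eqP->. Qed.

Lemma is_complex_sing (S : finSemigroupType) : is_complex (sing S).
Proof.
apply/is_complexP; split=> //.
- move=> X Y /subsingleton_sing sX /subsingleton_sing sY.
  apply: sing_subsingleton => _ _ /imset2P[x y Xx Yy ->] /imset2P[x' y' Xx' Yy' ->].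
  by rewrite (sX x x') // (sY y y').
- move=> X Y /subsingleton_sing sX /subsetP YX.
  by apply: sing_subsingleton => x y /YX Xx /YX; apply: sX.
Qed.

Section Restrict.
Variable O : contextSpecifier.

Lemma mem_cf_restrict (C : complexFunctor) (S : finSemigroupType) (U : subsgp S)
    (X : pset (subsgp_sgp U)) :
  U \in O S -> X \in (C (subsgp_sgp U) : {set _}) ->
  pset_map (@sgincl S U) X \in (cf_restrict O C S : {set _}).
Proof.
move=> OU CX; apply: (subsetP (sub_complex_gen _)).
by apply/bigcupP; exists U => //; apply: imset_f.
Qed.

Lemma cf_restrict_min (C : complexFunctor) (S : finSemigroupType) (K : complex S) :
  (forall (U : subsgp S), U \in O S -> forall X : pset (subsgp_sgp U),
     X \in (C (subsgp_sgp U) : {set _}) -> pset_map (@sgincl S U) X \in (K : {set _})) ->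
  (cf_restrict O C S : {set _}) \subset K.
Proof.
move=> CK; apply: complex_gen_min; apply/subsetP=> _ /bigcupP[U OU /imsetP[X CX ->]].
exact: CK.
Qed.

Lemma cf_restrict_decreasing : decreasing cf_le (cf_restrict O).
Proof.
move=> C S; apply: cf_restrict_min => U _ X.
exact: (@cf_pset_map C (subsgp_sgp U) S (@sgincl S U)).
Qed.

Lemma cf_restrict_monotone : monotone cf_le (cf_restrict O).
Proof.
move=> C D CD S; apply: cf_restrict_min => U OU X CX.
by apply: mem_cf_restrict => //; apply: (subsetP (CD _)).
Qed.

(** For the nontrivial inequality only the generators of the join at each [U]
   in [O S] have to be followed into [S]; such a generator comes from a single
   functor of the family, whose restriction contains its image. *)
Lemma cf_restrict_join : preserves_joins cf_join (cf_restrict O).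
Proof.
move=> A; apply: cf_le_anti; last first.
  by apply: cf_join_least => _ [C AC ->]; apply/cf_restrict_monotone/cf_join_ub.
move=> S; apply: cf_restrict_min => U OU.
apply: (complex_gen_map (f := @sgincl S U)) => X; rewrite inE => /asboolP[C AC CX].
have rCA : image_pred (cf_restrict O) A (cf_restrict O C) by exists C.
exact: subsetP (cf_join_ub rCA S) _ (mem_cf_restrict OU CX).
Qed.

(** Inclusions are injective, so they reflect singletons as well as preserve
   them: the generators at [S] are all singletons if and only if the functor is
   trivial on each member of [O S]. *)
Lemma Fix_cf_restrict (C : complexFunctor) :
  Fix (cf_restrict O C) = In_pv O (Fix C).
Proof.
apply: pv_le_anti => S.
- move=> /Fix_classP rS U OU; apply/Fix_classP => X CX x y Xx Xy; apply: val_inj.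
  by apply: rS (mem_cf_restrict OU CX) _ _ _ _; apply: imset_f.
- move=> IS; apply/Fix_classP => X rX; apply: subsingleton_sing; move: X rX.
  apply/subsetP/(cf_restrict_min (K := Complex (is_complex_sing S))) => U OU X CX.
  apply: pset_map_sing; have <- : (C (subsgp_sgp U) : {set _}) = sing _ := IS U OU.
  exact: CX.
Qed.

Lemma cf_restrict_algebraic : algebraic (cf_restrict O).
Proof.
split; first exact: cf_restrict_monotone.
by move=> C D CD; rewrite !Fix_cf_restrict CD.
Qed.

End Restrict.

Section Directed.
Variable A : pseudovariety -> Prop.
Hypothesis Adir : directed pv_le A.

Lemma directed_ub_seq (J : eqType) (s : seq J) (V : J -> pseudovariety) :
  (forall j, A (V j)) ->
  exists2 W, A W & forall j, j \in s -> pv_le (V j) W.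
Proof.
move=> AV; elim: s => [|j s [W AW sW]]; first by have [[W AW] _] := Adir; exists W.
have [W' [AW' jW' WW']] := Adir.2 _ _ (AV j) AW.
exists W' => // i; rewrite inE => /orP[/eqP->//|/sW iW] S /iW.
exact: WW'.
Qed.

(** A choice of one member of the family for each [j] has an upper bound in the
   family, by [directed_ub_seq].  Applied to the factors of a product, this shows
   that the union of the family is a pseudovariety; applied to the members of
   [O S], that [In_pv O] is continuous. *)
Lemma directed_finite (J : finType) (P : pred J) (S : J -> finSemigroupType) :
  (forall j, P j -> exists2 V : pseudovariety, A V & V (S j)) ->
  exists2 W : pseudovariety, A W & forall j, P j -> W (S j).
Proof.
move=> AS; have [[V0 AV0] _] := Adir.
(* Outside P any member of the family will do as the chosen one. *)
have /choice[V AV] j : exists V : pseudovariety, A V /\ (P j -> V (S j)).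
  case: (boolP (P j)) => [/AS[V AV VS]|_]; first by exists V.
  by exists V0; split.
have [W AW VW] := directed_ub_seq (enum J) (fun j => (AV j).1).
exists W => // j Pj; apply: (VW j); first exact: mem_enum.
exact: (AV j).2.
Qed.

Let union (S : finSemigroupType) : Prop := exists2 V : pseudovariety, A V & V S.

Fact directed_union_sub (S : finSemigroupType) (U : subsgp S) :
  union S -> union (subsgp_sgp U).
Proof. by case=> V AV VS; exists V => //; apply: pv_sub. Qed.

Fact directed_union_im (S T : finSemigroupType) (f : {multiplicative S -> T}) :
  surjective f -> union S -> union T.
Proof. by move=> fsurj [V AV VS]; exists V => //; apply: pv_im VS. Qed.

Fact directed_union_prod (I : finType) (S : I -> finSemigroupType) :
  (forall i, union (S i)) -> union (sgprod S).
Proof.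
move=> AS; have [W AW WS] := directed_finite (P := predT) (fun i _ => AS i).
by exists W => //; apply: pv_prod => i; apply: WS.
Qed.

Definition directed_union : pseudovariety :=
  Pseudovariety directed_union_sub directed_union_im directed_union_prod.

Lemma mem_directed_pv_join (S : finSemigroupType) :
  pv_join A S -> exists2 V : pseudovariety, A V & V S.
Proof. by apply: (pv_join_least (W := directed_union)) => V AV T VT; exists V. Qed.

End Directed.

Lemma In_pv_monotone (O : contextSpecifier) : monotone pv_le (In_pv O).
Proof. by move=> V W VW S IS U OU; apply/VW/IS. Qed.

Lemma In_pv_continuous (O : contextSpecifier) : continuous (In_pv O).
Proof.
split=> [|A Adir]; first exact: In_pv_monotone.
apply: pv_le_anti.
- move=> S IS.
  have [W AW WS] : exists2 W : pseudovariety, A W &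
      forall U : subsgp S, U \in O S -> W (subsgp_sgp U).
    by apply: (directed_finite Adir) => U OU; apply/(mem_directed_pv_join Adir)/IS.
  by apply: (pv_join_ub (V := In_pv O W)) WS; exists W.
- by apply: pv_join_least => _ [V AV ->]; apply/In_pv_monotone/pv_join_ub.
Qed.

Theorem mainTheorem6 (O : contextSpecifier) :
  [/\ decreasing cf_le (cf_restrict O),
      preserves_joins cf_join (cf_restrict O)
    & fixed_point_transfer (cf_restrict O) (In_pv O)].
Proof.
split; [exact: cf_restrict_decreasing|exact: cf_restrict_join|split].
- exact: cf_restrict_algebraic.
- exact: In_pv_continuous.
- exact: Fix_cf_restrict.
Qed.
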